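(* Let $((\Omega_i,\Sigma_i,\mathbb{P}_i))_{i=1}^n$ be probability spaces, let $(\Omega,\Sigma,\mathbb{P})$ be their product, and let $\Omega^*\subset \Omega$ be a (measurable) set of exceptional outcomes. Let $X:\Omega\to\mathbb R$ be a random variable, let $M=\max\{\sup |X|,1\}$, and let $c\geq 1$ and $s>0$. Suppose that $\mathbb{P}[\Omega^*]\leq M^{-2}$ and that $X$ has upward $(s,c)$-certificates or downward $(s,c)$-certificates (with respect to $\Omega^*$). Then for every $t> 50 c\sqrt{s}$, $$\mathbb{P}\big[\,|X- \mathbb{E}[X]|\geq t\,\big] \leq 4e^{-\frac{t^2}{16c^2s}}+4\,\mathbb{P}[\Omega^*].$$
   Context: Let $\Omega=\prod_{i=1}^n\Omega_i$, let $\Omega^*\subseteq\Omega$ be an exceptional set, let $s,c>0$, and let $X:\Omega\to\mathbb R$. For $\omega\in\Omega$ and an index set $I\subseteq\{1,\dots,n\}$, $\omega|_I$ denotes the restriction of $\omega$ to the coordinates in $I$. $X$ has upward $(s,c)$-certificates if for every $t>0$ and every $\omega\in\Omega\setminus\Omega^*$ there is an index set $I$ of size at most $s$ such that $X(\omega')>X(\omega)-t$ for every $\omega'\in\Omega\setminus\Omega^*$ for which $\omega|_I$ and $\omega'|_I$ differ in less than $t/c$ coordinates. $X$ has downward $(s,c)$-certificates if for every $t>0$ and every $\omega\in\Omega\setminus\Omega^*$ there is an index set $I$ of size at most $s$ such that $X(\omega')<X(\omega)+t$ for every $\omega'\in\Omega\setminus\Omega^*$ for which $\omega|_I$ and $\omega'|_I$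 differ in less than $t/c$ coordinates.
   Formalization: The hypothesis s>0 is replaced by s≥1 (s real): for small s<1 the index sets are empty and the claim fails, e.g. Ω={0,1}, P({1})=1/100, Ω*={1}, X(0)=0, X(1)=10, c=1, s=10^-8, t=1/20. *)

(* Defs.v *)
From HB Require Import structures.
From mathcomp Require Import all_boot all_order all_algebra.
From mathcomp Require Import all_classical all_reals all_analysis.

Set Implicit Arguments.
Unset Strict Implicit.
Unset Printing Implicit Defensive.

Import Order.TTheory GRing.Theory Num.Theory.

Local Open Scope classical_set_scope.
Local Open Scope ring_scope.

(* The library has the n-fold power of one measurable space (on tuples) and the
   product of two; here the n factors may be distinct spaces. *)
Definition prod_space (n : nat) (d : 'I_n -> measure_display)
  (T : forall i, measurableType (d i)) : Type := forall i, T i.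

Definition prod_display (n : nat) :
  ('I_n -> measure_display) -> measure_display.
Proof. by move=> _; exact: default_measure_display. Qed.

Section prod_space_measurable.
Context (n : nat) (d : 'I_n -> measure_display)
  (T : forall i, measurableType (d i)).

Definition cylinders : set (set (prod_space T)) :=
  \bigcup_(i in [set: 'I_n])
    preimage_set_system setT (fun w : prod_space T => w i) measurable.

HB.instance Definition _ := Choice.copy (prod_space T) (forall i, T i).
HB.instance Definition _ := isPointed.Build (prod_space T) (fun=> point).
HB.instance Definition _ := @isMeasurable.Build (prod_display d)
  (prod_space T) <<s cylinders >>
  (@sigma_algebra0 _ setT cylinders)
  (@sigma_algebraC _ cylinders)
  (@sigma_algebra_bigcup _ setT cylinders).

Lemma measurable_coord (i : 'I_n) :
  measurable_fun [set: prod_space T] (fun w : prod_space T => w i).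
Proof.
move=> _ A mA; apply: sub_sigma_algebra; exists i => //.
by exists A.
Qed.

Lemma measurable_fun_prod_space d' (U : measurableType d')
    (f : U -> prod_space T) :
  (forall i, measurable_fun [set: U] (fun u => f u i)) ->
  measurable_fun [set: U] f.
Proof.
move=> mf; apply: (measurability cylinders) => //.
move=> _ [_ [i _ [A mA <-]] <-]; rewrite !setTI.
by have := mf i measurableT A mA; rewrite setTI.
Qed.

Definition box (A : forall i, set (T i)) : set (prod_space T) :=
  [set w | forall i, A i (w i)].

Lemma measurable_box (A : forall i, set (T i)) :
  (forall i, measurable (A i)) -> measurable (box A).
Proof.
move=> mA.
have -> : box A = \bigcap_(i in [set: 'I_n])
    ((fun w : prod_space T => w i) @^-1` A i).
  by apply/seteqP; split=> [w Aw i _|w Aw i]; exact: Aw.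
apply: fin_bigcap_measurable => // i _.
by rewrite -[X in measurable X]setTI; exact: measurable_coord.
Qed.

Lemma measurable_prod_spaceE :
  @measurable _ (prod_space T) =
  <<s [set box A | A in [set A | forall i, measurable (A i)]] >>.
Proof.
apply/seteqP; split.
- apply: smallest_sub; first exact: smallest_sigma_algebra.
  move=> _ [i _ [A mA <-]]; apply: sub_sigma_algebra.
  exists (dfwith (fun j => [set: T j]) i A) => [j|].
    by have [->|ij] := eqVneq j i; [rewrite dfwithin|rewrite dfwithout// eq_sym].
  rewrite setTI; apply/seteqP; split=> w /=.
    by move=> /(_ i); rewrite dfwithin.
  move=> Aw j; have [->|ij] := eqVneq j i; first by rewrite dfwithin.
  by rewrite dfwithout// eq_sym.
- apply: smallest_sub; first exact: sigma_algebra_measurable.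
  by move=> _ [A mA <-]; exact: measurable_box.
Qed.

End prod_space_measurable.

Section prod_cons.
Context (n : nat) (d : 'I_n.+1 -> measure_display)
  (T : forall i, measurableType (d i)).

Definition prod_cons
    (x : T ord0 * prod_space (fun i : 'I_n => T (lift ord0 i))) :
    prod_space T :=
  fun i => match unliftP ord0 i with
           | UnliftSome j e => eq_rect_r (fun i => T i : Type) (x.2 j) e
           | UnliftNone e => eq_rect_r (fun i => T i : Type) x.1 e
           end.

Lemma prod_cons0 x : prod_cons x ord0 = x.1.
Proof.
rewrite /prod_cons; case: unliftP => [j e|e].
  by case/eqP: (neq_lift ord0 j).
by rewrite (eq_irrelevance e erefl).
Qed.

Lemma prod_consS x (j : 'I_n) : prod_cons x (lift ord0 j) = x.2 j.
Proof.
rewrite /prod_cons; case: unliftP => [k e|e].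
  have kj := lift_inj e; move: e; rewrite -kj => e.
  by rewrite (eq_irrelevance e erefl).
by case/eqP: (neq_lift ord0 j).
Qed.

Lemma measurable_prod_cons : measurable_fun setT prod_cons.
Proof.
apply: measurable_fun_prod_space => i.
have [j ->|->] := unliftP ord0 i.
- rewrite (_ : prod_cons^~ _ =
    (fun w : prod_space (fun i => T (lift ord0 i)) => w j) \o snd); last first.
    by apply/funext => x; exact: prod_consS.
  have h := @measurable_coord n _ (fun i => T (lift ord0 i)) j.
  exact: (measurableT_comp h measurable_snd).
- rewrite (_ : prod_cons^~ _ = fst); last first.
    by apply/funext => x; exact: prod_cons0.
  exact: measurable_fst.
Qed.

HB.instance Definition _ :=
  isMeasurableFun.Build _ _ _ _ prod_cons measurable_prod_cons.

End prod_cons.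

(* Iterated binary product, transported to prod_space; characterized by
   prod_probability_box and prod_probability_unique below. *)
Fixpoint prod_probability (R : realType) (n : nat) :
    forall (d : 'I_n -> measure_display) (T : forall i, measurableType (d i)),
    (forall i, probability (T i) R) -> probability (prod_space T) R :=
  match n with
  | 0 => fun d T P => dirac (point : prod_space T)
  | n'.+1 => fun d T P =>
      distribution
        (P ord0 \x prod_probability (fun i : 'I_n' => P (lift ord0 i)))%E
        (@prod_cons n' d T)
  end.

Lemma prod_probability_box (R : realType) (n : nat)
    (d : 'I_n -> measure_display) (T : forall i, measurableType (d i))
    (P : forall i, probability (T i) R) (A : forall i, set (T i)) :
  (forall i, measurable (A i)) ->
  prod_probability P (box A) = (\prod_(i < n) P i (A i))%E.
Proof.
elim: n d T P A => [|n IH] d T P A mA /=.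
  rewrite big_ord0 diracE mem_set//.
  by case.
rewrite big_ord_recl -(IH _ _ (fun i => P (lift ord0 i)) (fun i => A (lift ord0 i)))//.
rewrite /distribution /pushforward.
rewrite -product_measure1E//; last exact: measurable_box.
congr (_ _); apply/seteqP; split=> -[x w] /=.
- move=> Aw; split=> [|i] /=.
    by have := Aw ord0; rewrite prod_cons0.
  by have := Aw (lift ord0 i); rewrite prod_consS.
- move=> [/= Ax Aw] i; have [j ->|->] := unliftP ord0 i.
    by rewrite prod_consS; exact: Aw.
  by rewrite prod_cons0.
Qed.

Lemma prod_probability_unique (R : realType) (n : nat)
    (d : 'I_n -> measure_display) (T : forall i, measurableType (d i))
    (P : forall i, probability (T i) R) (Q : probability (prod_space T) R) :
  (forall A : (forall i, set (T i)), (forall i, measurable (A i)) ->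
    Q (box A) = (\prod_(i < n) P i (A i))%E) ->
  forall E : set (prod_space T), measurable E -> Q E = prod_probability P E.
Proof.
move=> QA E mE.
pose C := [set box A | A in [set A : forall i, set (T i) |
  forall i, measurable (A i)]].
apply: (measure_unique C (fun=> setT)) => //.
- exact: measurable_prod_spaceE.
- move=> _ _ [A mA <-] [B mB <-]; exists (fun i => A i `&` B i).
    by move=> i; exact: measurableI.
  by apply/seteqP; split=> w /= => [AB|[Aw Bw] i];
    [split=> i; case: (AB i)|split].
- move=> k; exists (fun=> setT) => //.
  by apply/seteqP; split.
- by apply/seteqP; split=> // w _; exists 0%N.
- by move=> _ [A mA <-]; rewrite /= QA// prod_probability_box.
- by move=> k; rewrite -ge0_fin_numE ?fin_num_measure.
Qed.

Section certificates.
Context (R : realType) (n : nat) (d : 'I_n -> measure_display)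
  (T : forall i, measurableType (d i)).

Definition diff_on (I : {set 'I_n}) (w w' : prod_space T) : nat :=
  #|[pred i in I | w i != w' i]|.

(* For s < 1 the index set is forced to be empty, and either notion says that X
   is constant off Ostar. *)
Definition upward_certificates (Ostar : set (prod_space T)) (s c : R)
    (X : prod_space T -> R) : Prop :=
  forall (t : R), 0 < t -> forall w, ~ Ostar w ->
  exists I : {set 'I_n}, #|I|%:R <= s /\
    forall w', ~ Ostar w' -> (diff_on I w w')%:R < t / c -> X w' > X w - t.

Definition downward_certificates (Ostar : set (prod_space T)) (s c : R)
    (X : prod_space T -> R) : Prop :=
  forall (t : R), 0 < t -> forall w, ~ Ostar w ->
  exists I : {set 'I_n}, #|I|%:R <= s /\
    forall w', ~ Ostar w' -> (diff_on I w w')%:R < t / c -> X w' < X w + t.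

(* In \bar R: if X is unbounded this is +oo, and then (sup_abs1 X ^+ 2)^-1
   is 0. *)
Definition sup_abs1 (X : prod_space T -> R) : \bar R :=
  maxe (ereal_sup [set `|X w|%:E | w in setT]) 1%E.

End certificates.

(* Main.v *)
(* Talagrand's inequality for certificates, then passage from a median to the
   mean.

   Talagrand's induction uses projections of measurable sets, which need not be
   measurable in arbitrary measurable spaces. Instead of the convex distance to
   a set, consider a finite family of functions f_k with weights nu_k summing
   to 1, and a function g such that, for all finite mixtures of points x_j
   compatible with the weights nu and all y,
     g(y) prod_j f_{p j}(x_j)^{mu_j}
       <= C exp(1/4 sum_i (sum_j mu_j [x_j and y differ at i])^2).
   Then E[g] prod_k E[f_k]^{nu_k} <= C. This property tensorizes by Fubini's
   theorem, because integrating out the last coordinates turns a mixture of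
   points into a new family of functions; so only the one-coordinate case needs
   an argument, and every function that is integrated is measurable. For
   indicators of sets A and B it gives P(A) P(B) <= exp(- r^2 / (4 s)) when
   every point of B has a set of at most s coordinates on at least r of which
   it differs from all points of A.

   With certificates this applies to {X <= a} and {X >= b} off the exceptional
   set, and bounds the deviation of X from a median. Summing the tail over
   layers of width 2 c sqrt(s) off the exceptional set, and using that the
   exceptional set has probability at most 1 / (sup |X|)^2, the mean is within
   20 c sqrt(s) of the median, hence within t / 2. *)

Require Import Defs.
From mathcomp Require Import all_boot all_order all_algebra.
From mathcomp Require Import all_classical all_reals all_analysis.
From mathcomp Require Import measurable_realfun ring lra.

Set Implicit Arguments.
Unset Strict Implicit.
Unset Printing Implicit Defensive.

Import Order.TTheory GRing.Theory Num.Theory.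
Import numFieldNormedType.Exports.

Local Open Scope classical_set_scope.
Local Open Scope ring_scope.

(** * Elementary inequalities for exponentials and weighted means *)

Section calculus.
Variable R : realType.
Implicit Types a v u x : R.

Lemma ge0_expRN_le x : 0 <= x -> expR (- x) <= 1 - x + x ^+ 2 / 2.
Proof.
move=> x0; pose f (y : R) : R := 1 - y + y ^+ 2 / 2 - expR (- y).
have df (y : R) : is_derive y 1 f (-1 + y + expR (- y)).
  by apply: is_derive_eq; rewrite /GRing.scale/=; field.
suff : f 0 <= f x by rewrite /f oppr0 expR0; lra.
apply: (@ger0_derive1_ndecry _ f 0) => //.
- move=> y _; rewrite derive1E; have [_ ->] := df y.
  by have := expR_ge1Dx (- y); lra.
- apply: derivable_within_continuous => y _.
  by have [] := df y.
Qed.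

Lemma ge0_expRN_ge x :
  0 <= x -> 1 - x + x ^+ 2 / 2 - x ^+ 3 / 6 <= expR (- x).
Proof.
move=> x0; pose f (y : R) : R := expR (- y) - (1 - y + y ^+ 2 / 2 - y ^+ 3 / 6).
have df (y : R) : is_derive y 1 f (- expR (- y) + (1 - y + y ^+ 2 / 2)).
  by apply: is_derive_eq; rewrite /GRing.scale/=; field.
suff : f 0 <= f x by rewrite /f oppr0 expR0; lra.
apply: (@ger0_derive1_ndecry _ f 0) => //.
- move=> y; rewrite in_itv/= andbT => y0.
  rewrite derive1E; have [_ ->] := df y.
  by have := ge0_expRN_le (ltW y0); lra.
- apply: derivable_within_continuous => y _.
  by have [] := df y.
Qed.

(** The expansions of the two terms cancel up to order two. With cubic coefficient [3/4] for
    [expR v], what remains is at most [- a ^+ 3 / 4 + a ^+ 4 / 2], which is nonpositive because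
    [a <= 1/2]. *)
Lemma expR_sum_le2 a : 0 <= a -> a <= 1/2 -> expR (a - a ^+ 2) + expR (- a) <= 2.
Proof.
move=> a0 a1; have := ge0_expRN_le a0.
set v := a - a ^+ 2.
have v0 : 0 <= v by rewrite /v expr2 -[X in X - _]mulr1 -mulrBr mulr_ge0 //; lra.
have v1 : v <= 1 / 4 by rewrite /v; nra.
have := ge0_expRN_ge v0.
(* This inverts the lower bound on [expR (- v)]: its product with the polynomial on the right is at
   least 1 when [v <= 1/4]. *)
have : expR v <= 1 + v + v ^+ 2 / 2 + 3/4 * v ^+ 3.
  have := ge0_expRN_ge v0; rewrite expRN => h.
  have ev := expR_gt0 v.
  set q := (X in _ <= X).
  rewrite -[leLHS]mulr1 -ler_pdivlMl//.
  set e := (expR v)^-1 in h *.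
  have q0 : 0 <= q by rewrite /q; nra.
  apply: le_trans (ler_wpM2r q0 h); rewrite /q.
  rewrite (_ : (1 - v + v ^+ 2 / 2 - v ^+ 3 / 6) *
    (1 + v + v ^+ 2 / 2 + 3/4 * v ^+ 3) = 1 + v ^+ 3 *
    (7/12 - 2/3 * v + v ^+ 2 * (7/24 - v / 8))); last by field.
  rewrite lerDl mulr_ge0 ?exprn_ge0// addr_ge0//; first by lra.
  by rewrite mulr_ge0 ?exprn_ge0//; lra.
have -> : v ^+ 3 = a ^+ 3 * (1 - a) ^+ 3 by rewrite /v; ring.
have a3 : 0 <= a ^+ 3 by apply: exprn_ge0.
have : a ^+ 3 * (1 - a) ^+ 3 <= a ^+ 3.
  apply: ler_piMr => //; apply: exprn_ile1; lra.
rewrite /v.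
have : a ^+ 3 * a <= a ^+ 3 / 2 by nra.
nra.
Qed.

(* The left side divided by [u `^ (1 - l)] is least at [l = - 2 * ln u], which
   is replaced by [1] when it exceeds [1]. *)
Lemma exists_powR_weight u : 0 <= u -> u <= 1 ->
  exists l, [/\ 0 <= l, l <= 1 & expR (l ^+ 2 / 4) <= (2 - u) * u `^ (1 - l)].
Proof.
move=> u0 u1; have [ub|ub] := leP (expR (- (1 / 2))) u.
  have up : 0 < u by apply: lt_le_trans ub; exact: expR_gt0.
  have l0 : ln u <= 0 by rewrite -ln1 ler_ln ?posrE.
  have l1 : - (1/2) <= ln u by rewrite -[leLHS]expRK ler_ln ?posrE ?expR_gt0.
  exists (- 2 * ln u); split; [lra|lra|].
  rewrite /powR gt_eqF// -[u in 2 - u]lnK ?posrE//.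
  set a := ln u in l0 l1 *.
  have h : expR (- a - a ^+ 2) + expR a <= 2.
    have := @expR_sum_le2 (- a); rewrite opprK sqrrN; apply; lra.
  apply: le_trans (_ : expR (- a - a ^+ 2) * expR ((1 - - 2 * a) * a) <= _).
    by rewrite -expRD ler_expR; lra.
  by apply: ler_wpM2r; [exact: expR_ge0|lra].
(* For [l = 1] the claim is [expR (1/4) <= 2 - u], which follows from [expR (1/4) <= 11/8] and
   [u < expR (- (1/2)) <= 5/8]. *)
exists 1; rewrite subrr powRr0 mulr1 expr1n ler01 lexx; split => //.
have := @ge0_expRN_ge (1/4).
have := @ge0_expRN_le (1/2).
have : expR (1/4) * expR (- (1/4)) = 1 :> R by rewrite -expRD subrr expR0.
set p := expR (1/4); set q := expR _; set r := expR _ in ub *.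
have : 0 < p by exact: expR_gt0.
move=> ? ? ? ?; have hr : r <= 5/8 by lra.
have hq : 1 - 1/4 + (1/4) ^+ 2 / 2 - (1/4) ^+ 3 / 6 <= q by lra.
suff : p <= 11/8 by lra.
nra.
Qed.

(** Weighted AM-GM, by [x k <= S * expR (x k / S - 1)] for the mean [S]: the exponents, weighted by
    [nu], sum to 0. *)
Lemma sum_prod_powR_le (K : finType) (nu x : K -> R) :
  (forall k, 0 <= nu k) -> \sum_k nu k = 1 -> (forall k, 0 <= x k) ->
  \prod_k (x k) `^ (nu k) <= \sum_k nu k * x k.
Proof.
move=> nu0 nu1 x0; set S := \sum_k nu k * x k.
have S0 : 0 <= S by apply: sumr_ge0 => k _; exact: mulr_ge0.
(* If some [x k] of nonzero weight vanishes, so does the product; otherwise [S] is positive. *)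
have [[k [xk nk]]|xS] := pselect (exists k, x k = 0 /\ nu k != 0).
  by rewrite (bigD1 k)//= xk powR0// mul0r.
have Sp : 0 < S.
  rewrite lt_neqAle S0 andbT eq_sym; apply/eqP => /eqP.
  rewrite psumr_eq0 => [/allP h|k _]; last exact: mulr_ge0.
  suff : \sum_k nu k = 0 by rewrite nu1 => /eqP; rewrite oner_eq0.
  apply: big1 => k _; have := h k (mem_index_enum k); rewrite mulf_eq0 => /orP[/eqP//|xk].
  by apply/eqP; apply/negPn/negP => nk; apply: xS; exists k; rewrite (eqP xk).
apply: le_trans (_ : \prod_k (S `^ nu k * expR (nu k * (x k / S - 1))) <= _).
  apply: ler_prod => k _; rewrite powR_ge0/=.
  have -> : nu k * (x k / S - 1) = (x k / S - 1) * nu k by rewrite mulrC.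
  rewrite expRM -powRM ?expR_ge0//.
  apply: ge0_ler_powR; rewrite ?nnegrE//; first by rewrite mulr_ge0 ?expR_ge0.
  rewrite -ler_pdivrMl//.
  by have := expR_ge1Dx (x k / S - 1); rewrite [_ * x k]mulrC; lra.
rewrite big_split/= -expR_sum.
have -> : \sum_k nu k * (x k / S - 1) = 0.
  under eq_bigr do rewrite mulrBr mulr1 mulrA.
  by rewrite sumrB -mulr_suml nu1 mulfV ?subrr// gt_eqF.
rewrite expR0 mulr1.
have -> : \prod_k S `^ nu k = S `^ (\sum_k nu k).
  by rewrite /powR gt_eqF// -expR_sum -mulr_suml.
by rewrite nu1 powRr1.
Qed.

End calculus.

(** * Domination, and functions with values in the unit interval *)

Definition unit_mfun d (T : measurableType d) (R : realType) (f : T -> R) :=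
  measurable_fun setT f /\ forall w, 0 <= f w <= 1.

(* The mass [nu k] of each [f k] may be spread over several points [x j],
   [p j = k]. Since [0 `^ 0 = 1], points of weight [0] do not matter. *)
Definition dominated (R : realType) (W : Type)
    (cost : forall J : finType, (J -> R) -> (J -> W) -> W -> R)
    (K : finType) (nu : K -> R) (f : K -> W -> R) (g : W -> R) (C : R) :=
  forall (J : finType) (p : J -> K) (mu : J -> R) (x : J -> W) (y : W),
    (forall j, 0 <= mu j) ->
    (forall k, \sum_(j | p j == k) mu j = nu k) ->
  g y * \prod_j f (p j) (x j) `^ mu j <= C * expR (cost J mu x y / 4).

Definition coord_cost (R : realType) (T : eqType)
    (J : finType) (mu : J -> R) (x : J -> T) (y : T) : R :=
  (\sum_j mu j * (x j != y)%:R) ^+ 2.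

(** The variance of [x] under the weights [nu] is nonnegative. *)
Lemma sqr_sum_le (R : realFieldType) (K : finType) (nu x : K -> R) :
  (forall k, 0 <= nu k) -> \sum_k nu k = 1 ->
  (\sum_k nu k * x k) ^+ 2 <= \sum_k nu k * x k ^+ 2.
Proof.
move=> nu0 nu1; set m := \sum_k nu k * x k.
have : 0 <= \sum_k nu k * (x k - m) ^+ 2.
  by apply: sumr_ge0 => k _; rewrite mulr_ge0 ?sqr_ge0.
rewrite (eq_bigr (fun k => nu k * x k ^+ 2 - 2 * m * (nu k * x k) + m ^+ 2 * nu k));
  last by move=> k _; ring.
rewrite big_split/= sumrB -!mulr_sumr nu1 -/m; lra.
Qed.

Section unit_mfun.
Context d (T : measurableType d) (R : realType) (P : probability T R).
Implicit Types f g : T -> R.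

Lemma unit_mfun_integrable f : unit_mfun f -> P.-integrable setT (EFin \o f).
Proof.
move=> [mf f01]; apply: measurable_bounded_integrable => //.
  by rewrite -ge0_fin_numE ?fin_num_measure.
exists 1; split => // M M1 w _ /=; have /andP[f0 f1] := f01 w.
by rewrite ger0_norm// (le_trans f1)// ltW.
Qed.

Lemma Rintegral_unit_mfun f : unit_mfun f -> 0 <= \int[P]_w f w <= 1.
Proof.
move=> uf; have /unit_mfun_integrable fi := uf.
case: uf => mf f01; apply/andP; split.
  by apply: Rintegral_ge0 => w _; case/andP: (f01 w).
apply: le_trans (_ : \int[P]_w (cst 1) w <= _).
  apply: le_Rintegral => //; first exact: finite_measure_integrable_cst.
  by move=> w _; case/andP: (f01 w).
by rewrite Rintegral_cst//= probability_setT/= mul1r.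
Qed.

Lemma Rintegral_sum (K : finType) (f : K -> T -> R) :
  (forall k, P.-integrable setT (EFin \o f k)) ->
  \int[P]_w (\sum_k f k w) = \sum_k \int[P]_w f k w.
Proof.
move=> fi; rewrite /Rintegral.
under eq_integral do rewrite -sumEFin.
rewrite integral_sum//= sum_fine//.
by move=> k _; apply: integrable_fin_num => //; exact: fi.
Qed.

(** The supremum need not be attained. If it is positive, [theta] times it is strictly smaller,
    hence exceeded at some point; if it is 0, any point will do. *)
Lemma exists_near_sup f (theta : R) : unit_mfun f -> 0 <= theta < 1 ->
  exists x, forall y, theta * f y <= f x.
Proof.
move=> [_ f01] /andP[t0 t1].
have [[z fz]|f0] := pselect (exists z, 0 < f z); last first.
  exists point => y; have -> : f y = 0.
    apply/eqP; rewrite eq_le; case/andP: (f01 y) => -> _.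
    by rewrite andbT leNgt; apply/negP => fy; apply: f0; exists y.
  by rewrite mulr0; case/andP: (f01 point).
have sf : has_sup (range f).
  split; first by exists (f z), z.
  by exists 1 => _ [w _ <-]; case/andP: (f01 w).
have fs y : f y <= sup (range f) by apply: ub_le_sup; [case: sf|exists y].
have s0 : 0 < sup (range f) by apply: lt_le_trans (fs z).
have : 0 < (1 - theta) * sup (range f) by rewrite mulr_gt0// subr_gt0.
move=> /sup_adherent/(_ sf)[_ [x _ <-] fx]; exists x => y.
apply: le_trans (ltW fx).
have := ler_wpM2l t0 (fs y); lra.
Qed.

End unit_mfun.

(** * The inequality for one coordinate *)

Section one_coordinate.
Context d (T : measurableType d) (R : realType) (P : probability T R).
Variables (K : finType) (nu : K -> R) (f : K -> T -> R) (g : T -> R) (C : R).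
Hypotheses (nu0 : forall k, 0 <= nu k) (nu1 : \sum_k nu k = 1).
Hypotheses (uf : forall k, unit_mfun (f k)) (ug : unit_mfun g) (C0 : 0 <= C).
Hypothesis H : dominated (@coord_cost R T) nu f g C.

Let A k := \int[P]_w f k w.

Let A01 k : 0 <= A k <= 1.
Proof. exact: Rintegral_unit_mfun. Qed.

(* Splitting the mass [nu k] between the point [y] itself and a near-maximizer
   [x k] of [f k], with the split depending on [y], bounds [g y] by a
   measurable function of [y]; no measurability of the cost is involved. *)
Lemma near_sup_bound (theta : R) (x : K -> T) (y : T) : 0 <= theta <= 1 ->
  (forall k y, theta * f k y <= f k (x k)) ->
  (forall k, nu k != 0 -> 0 < f k (x k)) ->
  g y * \prod_k f k (x k) `^ nu k <=
  C * \prod_k (2 - theta * f k y / f k (x k)) `^ nu k.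
Proof.
move=> /andP[t0 t1] xmax xpos.
pose a k := f k (x k); pose u k := theta * f k y / a k.
have f0 k w : 0 <= f k w by case: (uf k) => _ /(_ w)/andP[].
have u0 k : 0 <= u k by rewrite /u /a divr_ge0 ?mulr_ge0 ?f0.
have u1 k : u k <= 1.
  have : 0 <= a k by exact: f0.
  rewrite le_eqVlt => /predU1P[a0|a0].
    by rewrite /u -a0 invr0 mulr0.
  by rewrite ler_pdivrMr// mul1r xmax.
pose l k := projT1 (cid (exists_powR_weight (u0 k) (u1 k))).
have [l0 l1 lu] : [/\ forall k, 0 <= l k, forall k, l k <= 1 &
    forall k, expR (l k ^+ 2 / 4) <= (2 - u k) * u k `^ (1 - l k)].
  by split=> k; rewrite /l; case: cid => ? [].
pose mu (j : K * bool) := nu j.1 * (if j.2 then l j.1 else 1 - l j.1).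
pose z (j : K * bool) := if j.2 then x j.1 else y.
have sumKb (F : K * bool -> R) : \sum_j F j = \sum_k (F (k, true) + F (k, false)).
  rewrite (eq_bigr (fun j => F (j.1, j.2))); last by case.
  rewrite -(pair_bigA _ (fun k b => F (k, b)))/=.
  by apply: eq_bigr => k _; rewrite big_bool.
have prodKb (F : K * bool -> R) : \prod_j F j = \prod_k (F (k, true) * F (k, false)).
  rewrite (eq_bigr (fun j => F (j.1, j.2))); last by case.
  rewrite -(pair_bigA _ (fun k b => F (k, b)))/=.
  by apply: eq_bigr => k _; rewrite big_bool.
have mu0 j : 0 <= mu j.
  by rewrite mulr_ge0//; case: ifP => // _; rewrite subr_ge0.
have munu k : \sum_(j | j.1 == k) mu j = nu k.
  rewrite big_mkcond sumKb (bigD1 k)//= eqxx big1 => [|i /negbTE->]; last by rewrite addr0.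
  by rewrite /mu/=; ring.
have := H z y mu0 munu; rewrite prodKb /coord_cost sumKb/=.
set cost := (\sum_k _) ^+ 2.
(* The mass kept at [y] is free. Bounding each indicator [x k != y] by 1 leaves a quantity depending
   on the split [l] alone. *)
have costE : cost <= \sum_k nu k * l k ^+ 2.
  apply: le_trans (sqr_sum_le l nu0 nu1).
  rewrite ler_sqr ?nnegrE; last 2 first.
  - by apply: sumr_ge0 => k _; rewrite addr_ge0// mulr_ge0.
  - by apply: sumr_ge0 => k _; rewrite mulr_ge0.
  apply: ler_sum => k _; rewrite /z/= eqxx mulr0 addr0 /mu/=.
  by rewrite ler_piMr ?mulr_ge0// lern1 leq_b1.
move=> gle.
(* Here [a k * u k = theta * f k y <= f k y], so the values at [x k] and [y] are bounded below in
   terms of [a k] and [u k]. *)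
have fw k : a k `^ nu k * (u k `^ (1 - l k)) `^ nu k <=
    f k (x k) `^ mu (k, true) * f k y `^ mu (k, false).
  rewrite /mu/= -/(a k).
  have [->|nk] := eqVneq (nu k) 0; first by rewrite !mul0r !powRr0.
  have ak : 0 < a k by exact: xpos.
  rewrite -powRrM [(1 - l k) * _]mulrC.
  have -> : a k `^ nu k = a k `^ (nu k * l k) * a k `^ (nu k * (1 - l k)).
    by rewrite -powRD ?(gt_eqF ak) ?implybT//; congr (_ `^ _); ring.
  rewrite -mulrA ler_wpM2l ?powR_ge0// -powRM ?(ltW ak)//.
  apply: ge0_ler_powR; rewrite ?nnegrE.
  - by rewrite mulr_ge0 ?subr_ge0.
  - by rewrite mulr_ge0 ?(ltW ak).
  - exact: f0.
  - by rewrite mulrC divfK ?gt_eqF// ler_piMl.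
(* The factor to be cancelled is positive even if some [u k = 0]: by [lu] its product with [2 - u k]
   exceeds an exponential. *)
pose w k := (u k `^ (1 - l k)) `^ nu k.
have w0 : 0 < \prod_k w k.
  apply: prodr_gt0 => k _; apply: powR_gt0.
  have := lt_le_trans (expR_gt0 _) (lu k).
  by rewrite pmulr_rgt0// subr_gt0 (le_lt_trans (u1 k))// ltr1n.
rewrite -(ler_pM2r w0) -!mulrA -!big_split/=.
have g0 : 0 <= g y by case: ug => _ /(_ y)/andP[].
apply: le_trans (_ : g y * \prod_k
    (f k (x k) `^ mu (k, true) * f k y `^ mu (k, false)) <= _).
  apply: ler_wpM2l => //; apply: ler_prod => k _.
  by rewrite mulr_ge0 ?powR_ge0 ?fw.
apply: (le_trans gle); apply: ler_wpM2l => //.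
apply: le_trans (_ : \prod_k (expR (l k ^+ 2 / 4)) `^ nu k <= _).
  under eq_bigr do rewrite -expRM.
  rewrite -expR_sum ler_expR.
  under eq_bigr do rewrite mulrAC.
  rewrite -mulr_suml; apply: ler_wpM2r; first by rewrite invr_ge0.
  by under eq_bigr do rewrite mulrC.
apply: ler_prod => k _; rewrite powR_ge0/= -powRM ?powR_ge0//.
  apply: ge0_ler_powR; rewrite ?nnegrE ?expR_ge0//.
  by rewrite mulr_ge0 ?powR_ge0// subr_ge0 (le_trans (u1 k))// ler1n.
by rewrite subr_ge0 (le_trans (u1 k))// ler1n.
Qed.

Lemma coord_inequality : (\int[P]_w g w) * \prod_k A k `^ nu k <= C.
Proof.
have A0 k : 0 <= A k by case/andP: (A01 k).
have G0 : 0 <= \int[P]_w g w by case/andP: (Rintegral_unit_mfun P ug).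
set Z := \prod_k _.
have Z0 : 0 <= Z by apply: prodr_ge0 => k _; exact: powR_ge0.
have tC theta : 0 < theta < 1 -> theta * ((\int[P]_w g w) * Z) <= C; last first.
  have [//|ZC] := leP ((\int[P]_w g w) * Z) C.
  set X := _ * Z in tC ZC *; have X0 : 0 < X by apply: le_lt_trans ZC.
  have X2 : 0 < 2 * X by rewrite mulr_gt0.
  have CX : 0 < C + X by rewrite ltr_wpDl.
  (* If [X > C], this [theta] is below 1 and [theta * X] is the midpoint of [C] and [X], hence above
     [C]. *)
  have := tC ((C + X) / (2 * X)); rewrite divr_gt0//= ltr_pdivrMr// mul1r.
  rewrite (_ : (C + X) / (2 * X) * X = (C + X) / 2); last by field; rewrite gt_eqF.
  by move=> h; have := h ltac:(lra); lra.
move=> /andP[t0 t1].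
have t01 : 0 <= theta < 1 by rewrite ltW.
pose x k := projT1 (cid (exists_near_sup (uf k) t01)).
have xmax k y : theta * f k y <= f k (x k) by rewrite /x; case: cid.
have f0 k w : 0 <= f k w by case: (uf k) => _ /(_ w)/andP[].
(* A near-maximum equal to 0 forces [f k = 0], as [theta > 0]; then [Z = 0]. *)
have [[k [nk ak]]|xpos] := pselect (exists k, nu k != 0 /\ f k (x k) = 0).
  suff -> : Z = 0 by rewrite !mulr0.
  rewrite /Z (bigD1 k)//= (_ : A k = 0) ?powR0 ?mul0r//.
  rewrite /A (_ : f k = cst 0); last first.
    apply/funext => w; apply/eqP; rewrite eq_le f0 andbT.
    by have := xmax k w; rewrite ak pmulr_rle0.
  by rewrite Rintegral_cst// mul0r.
have {}xpos k : nu k != 0 -> 0 < f k (x k).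
  by move=> nk; rewrite lt_neqAle f0 andbT eq_sym; apply/eqP => ak; apply: xpos; exists k.
have t01' : 0 <= theta <= 1 by rewrite !ltW.
(* If [a k = 0], which now requires [nu k = 0], the convention [0^-1 = 0] gives [u k = 0] and
   [U k = 0]. *)
pose a k := f k (x k); pose u k y := theta * f k y / a k.
pose U k := theta * A k / a k.
have fi k := unit_mfun_integrable P (uf k).
have gi := unit_mfun_integrable P ug.
have U0 k : 0 <= U k by rewrite /U /a divr_ge0 ?mulr_ge0 ?f0// ltW.
have u1 k y : u k y <= 1.
  have : 0 <= a k by exact: f0.
  rewrite le_eqVlt => /predU1P[a0|a0].
    by rewrite /u -a0 invr0 mulr0.
  by rewrite ler_pdivrMr// mul1r xmax.
have tZ : theta * Z = \prod_k (theta * A k) `^ nu k.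
  under eq_bigr do rewrite powRM ?(ltW t0)//.
  rewrite big_split/=; congr (_ * _).
  by rewrite /powR gt_eqF// -expR_sum -mulr_suml nu1 mul1r lnK.
have bound y : g y * (theta * Z) <=
    \sum_k (2 * C * nu k * U k - C * nu k * U k * theta / a k * f k y).
  rewrite tZ.
  have -> : \prod_k (theta * A k) `^ nu k = \prod_k a k `^ nu k * \prod_k U k `^ nu k.
    rewrite -big_split/=; apply: eq_bigr => k _.
    have [->|nk] := eqVneq (nu k) 0; first by rewrite !powRr0 mulr1.
    rewrite -powRM//; last exact: f0.
    by rewrite /U [a k * _]mulrC divfK// gt_eqF//; exact: xpos.
  rewrite mulrA; apply: le_trans
    (_ : (C * \prod_k (2 - u k y) `^ nu k) * \prod_k U k `^ nu k <= _).
    apply: ler_wpM2r; first by apply: prodr_ge0 => k _; exact: powR_ge0.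
    exact: near_sup_bound.
  have u2 k : 0 <= 2 - u k y by rewrite subr_ge0 (le_trans (u1 k y))// ler1n.
  rewrite -mulrA -big_split/=.
  under eq_bigr do rewrite -powRM//.
  apply: le_trans (_ : C * \sum_k nu k * ((2 - u k y) * U k) <= _).
    by apply: ler_wpM2l => //; apply: sum_prod_powR_le => // k; rewrite mulr_ge0.
  by rewrite mulr_sumr le_eqVlt; apply/orP; left; apply/eqP;
    apply: eq_bigr => k _; rewrite /u; ring.
have ci (c : R) : P.-integrable setT (EFin \o (cst c)).
  exact: finite_measure_integrable_cst.
have si k : P.-integrable setT (EFin \o (fun y =>
    2 * C * nu k * U k - C * nu k * U k * theta / a k * f k y)).
  exact: (integrableB measurableT (ci _) (integrableZl measurableT _ (fi k))).
have -> : theta * ((\int[P]_w g w) * Z) = \int[P]_y (g y * (theta * Z)).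
  by rewrite RintegralZr//; ring.
apply: le_trans (_ : \int[P]_y (\sum_k
    (2 * C * nu k * U k - C * nu k * U k * theta / a k * f k y)) <= _).
  apply: le_Rintegral => //; first exact: (integrableZr measurableT _ gi).
  rewrite (_ : _ \o _ = fun y => (\sum_k
      (2 * C * nu k * U k - C * nu k * U k * theta / a k * f k y)%:E)%E).
    by apply: integrable_sum => // k _; exact: si.
  by apply/funext => y /=; rewrite sumEFin.
rewrite Rintegral_sum//.
apply: le_trans (_ : \sum_k C * nu k <= _); last by rewrite -mulr_sumr nu1 mulr1.
apply: ler_sum => k _.
rewrite RintegralB//; [|exact: ci|exact: (integrableZl measurableT _ (fi k))].
rewrite Rintegral_cst//= probability_setT mulr1 RintegralZl// -/(A k).
rewrite (_ : _ - _ * A k = C * nu k - C * nu k * (1 - U k) ^+ 2).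
  by rewrite gerBl mulr_ge0 ?sqr_ge0// mulr_ge0.
by rewrite /U; ring.
Qed.

End one_coordinate.

(** * Tensorization and Talagrand's inequality *)

Definition prod_cost (R : realType) (n : nat) (d : 'I_n -> measure_display)
    (T : forall i, measurableType (d i))
    (J : finType) (mu : J -> R) (x : J -> prod_space T) (y : prod_space T) : R :=
  \sum_i (\sum_j mu j * (x j i != y i)%:R) ^+ 2.

Section first_coordinate.
Context (R : realType) (n : nat) (d : 'I_n.+1 -> measure_display)
  (T : forall i, measurableType (d i)) (P : forall i, probability (T i) R).
Let S := prod_probability (fun i : 'I_n => P (lift ord0 i)).

Variables (h : prod_space T -> R) (uh : unit_mfun h).

Let mcons : measurable_fun setT (h \o @prod_cons n d T).
Proof. exact: (measurableT_comp uh.1 (@measurable_prod_cons n d T)). Qed.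

Lemma unit_mfun_section x : unit_mfun (fun w => h (prod_cons (x, w))).
Proof.
split; last by move=> w; case: uh.
exact: (measurableT_comp mcons (pair1_measurable x)).
Qed.

Let sectionE x :
  (\int[S]_w (h (prod_cons (x, w)))%:E)%E =
  (\int[S]_w h (prod_cons (x, w)))%:E.
Proof.
rewrite /Rintegral fineK//.
apply: integrable_fin_num => //.
exact: (unit_mfun_integrable S (unit_mfun_section x)).
Qed.

(** Partial integrals stay in the class to which [coord_inequality] applies; measurability in [x]
    comes from Fubini-Tonelli. *)
Lemma unit_mfun_partial_integral :
  unit_mfun (fun x => \int[S]_w h (prod_cons (x, w))).
Proof.
split; last by move=> x; apply/Rintegral_unit_mfun/unit_mfun_section.
apply/measurable_EFinP.
rewrite (_ : _ \o _ = fubini_F S (EFin \o (h \o @prod_cons n d T))).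
  apply: measurable_fun_fubini_tonelli_F => //; first exact/measurable_EFinP.
  by move=> w; rewrite lee_fin; case: uh => _ /(_ (prod_cons w))/andP[].
by apply/funext => x /=; rewrite -sectionE.
Qed.

Lemma Rintegral_prod_probability :
  \int[prod_probability P]_w h w =
  \int[P ord0]_x (\int[S]_w h (prod_cons (x, w))).
Proof.
have h0 w : 0 <= h w by case: uh => _ /(_ w)/andP[].
rewrite /Rintegral; congr fine.
rewrite ge0_integral_distribution//; last first.
  by apply/measurable_EFinP; case: uh.
rewrite fubini_tonelli1; last 2 first.
- exact/measurable_EFinP.
- by move=> w; rewrite lee_fin; exact: h0.
by apply: eq_integral => x _; rewrite -sectionE.
Qed.

End first_coordinate.

(** Induction on [n], with [coord_inequality] applied to the partial integrals. Their domination at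
    a mixture [x] of first coordinates is the induction hypothesis with index set [J], weights [mu],
    the sections at the [x j], and the constant multiplied by the exponential of the first cost.
    This is why the family [f] and the constant [C] vary in the induction. *)
Lemma product_inequality (R : realType) (n : nat) (d : 'I_n -> measure_display)
    (T : forall i, measurableType (d i)) (P : forall i, probability (T i) R)
    (K : finType) (nu : K -> R) (f : K -> prod_space T -> R)
    (g : prod_space T -> R) (C : R) :
  (forall k, 0 <= nu k) -> \sum_k nu k = 1 ->
  (forall k, unit_mfun (f k)) -> unit_mfun g -> 0 <= C ->
  dominated (@prod_cost R n d T) nu f g C ->
  (\int[prod_probability P]_w g w) *
    \prod_k (\int[prod_probability P]_w f k w) `^ nu k <= C.
Proof.
elim: n d T P K nu f g C => [|n IH] d T P K nu f g C nu0 nu1 uf ug C0 H.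
  have diracE h : unit_mfun h -> \int[prod_probability P]_w h w = h point.
    move=> [mh _]; rewrite /Rintegral/= integral_dirac//; last exact/measurable_EFinP.
    by rewrite diracT mul1e.
  rewrite diracE//.
  under eq_bigr do rewrite diracE//.
  have := H K id nu (fun=> point) point nu0.
  rewrite /prod_cost big_ord0 mul0r expR0 mulr1; apply.
  by move=> k; rewrite big_pred1_eq.
rewrite Rintegral_prod_probability//.
under eq_bigr do rewrite Rintegral_prod_probability//.
apply: coord_inequality => // [k||].
- exact: unit_mfun_partial_integral.
- exact: unit_mfun_partial_integral.
move=> J p mu x y mu0 pmu.
have mu1 : \sum_j mu j = 1.
  rewrite -nu1 (partition_big p predT)//=.
  by apply: eq_bigr => k _; rewrite pmu.
apply: (IH _ _ _ J mu (fun j w => f (p j) (prod_cons (x j, w)))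
  (fun w => g (prod_cons (y, w)))) => //.
- by move=> j; exact: unit_mfun_section.
- exact: unit_mfun_section.
- by rewrite mulr_ge0 ?expR_ge0.
move=> J' p' mu' x' y' mu'0 pmu'.
rewrite -mulrA -expRD -mulrDl.
have pm k : \sum_(j | p (p' j) == k) mu' j = nu k.
  rewrite -pmu (partition_big p' (fun j => p j == k))//=.
  apply: eq_bigr => j /eqP pj; rewrite -pmu'; apply: eq_bigl => j'.
  by case: (p' j' =P j) => [->|]; rewrite ?pj ?eqxx ?andbF.
(* Pasting [x (p' j)] in front of [x' j] gives one mixture on the whole product, whose cost is the
   first-coordinate cost plus the remaining one. *)
have := H J' (p \o p') mu' (fun j => prod_cons (x (p' j), x' j))
  (prod_cons (y, y')) mu'0 pm.
rewrite /prod_cost big_ord_recl /coord_cost => /le_trans; apply.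
rewrite ler_wpM2l// ler_expR ler_wpM2r ?invr_ge0// lerD//.
  rewrite (partition_big p' predT)//=.
  rewrite le_eqVlt; apply/orP; left; apply/eqP; congr (_ ^+ 2).
  apply: eq_bigr => j _; rewrite -pmu' mulr_suml; apply: eq_bigr => j' /eqP <-.
  by rewrite !prod_cons0.
apply: ler_sum => i _.
by under eq_bigr do rewrite !prod_consS.
Qed.

(** Take one function, the indicator of [A], and let [g] be that of [B]. For a mixture of points of
    [A] and [y] in [B], let [q i] be the mass differing from [y] at [i]. Averaging the hypothesis
    gives a sum of [q] over [I] of at least [r], and Cauchy-Schwarz a cost of at least
    [r ^+ 2 / s]. *)
Lemma talagrand_certificates (R : realType) (n : nat)
    (d : 'I_n -> measure_display) (T : forall i, measurableType (d i))
    (P : forall i, probability (T i) R) (A B : set (prod_space T)) (s r : R) :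
  measurable A -> measurable B -> 0 < s -> 0 <= r ->
  (forall y, B y -> exists I : {set 'I_n}, #|I|%:R <= s /\
     forall x, A x -> r <= (diff_on I x y)%:R) ->
  fine (prod_probability P A) * fine (prod_probability P B) <=
  expR (- (r ^+ 2 / (4 * s))).
Proof.
move=> mA mB s0 r0 AB.
have uI (D : set (prod_space T)) : measurable D -> unit_mfun (\1_D : _ -> R).
  move=> mD; split; first exact: measurable_indic.
  by move=> w; rewrite indicE ler0n lern1 leq_b1.
have ID D : measurable D ->
    \int[prod_probability P]_w \1_D w = fine (prod_probability P D).
  by move=> mD; rewrite /Rintegral integral_indic// setIT.
have unit1 : (fun=> true) =1 pred1 tt by case.
apply: le_trans (_ : (\int[prod_probability P]_w \1_B w) *
  \prod_(k : unit) (\int[prod_probability P]_w \1_A w) `^ 1 <= _).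
  by rewrite (big_pred1 tt)// powRr1 !ID// ?fine_ge0// mulrC.
apply: (@product_inequality R n d T P unit (fun=> 1) (fun=> \1_A) \1_B) => //.
- by rewrite (big_pred1 tt).
- by move=> _; exact: uI.
- exact: uI.
move=> J p mu x y mu0 mu1.
have {}mu1 : \sum_j mu j = 1.
  by rewrite -(mu1 tt); apply: eq_bigl => j; case: (p j).
rewrite [\1_B y]indicE; have [yB|yB] := boolP (y \in B); last first.
  by rewrite mul0r mulr_ge0 ?expR_ge0.
(* A point of nonzero weight outside [A] makes the left side 0. *)
have [[j [muj xj]]|xA] := pselect (exists j, mu j != 0 /\ ~ A (x j)).
  rewrite (bigD1 j)//= indicE memNset// powR0// mul0r mulr0.
  by rewrite mulr_ge0 ?expR_ge0.
apply: le_trans (_ : 1 <= _).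
  rewrite mul1r; apply: prodr_ile1 => j _; rewrite powR_ge0/= indicE.
  by case: (_ \in _); rewrite ?powR1// /powR eqxx lern1 leq_b1.
rewrite -expRD -[leLHS]expR0 ler_expR.
have [I [Is ry]] := AB y (set_mem yB).
pose q i := \sum_j mu j * (x j i != y i)%:R.
have q0 i : 0 <= q i by apply: sumr_ge0 => j _; rewrite mulr_ge0.
have rq : r <= \sum_(i in I) q i.
  have -> : r = \sum_j mu j * r by rewrite -mulr_suml mu1 mul1r.
  rewrite exchange_big/=; apply: ler_sum => j _; rewrite -mulr_sumr.
  have [->|muj] := eqVneq (mu j) 0; first by rewrite !mul0r.
  apply: ler_wpM2l => //.
  have /ry : A (x j) by apply: contrapT => nA; apply: xA; exists j.
  move=> /le_trans; apply.
  rewrite /diff_on -sum1_card natr_sum.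
  rewrite (eq_bigl (fun i => (i \in I) && (x j i != y i))) => [|i]; last by rewrite inE.
  by rewrite big_mkcondr/=; apply: ler_sum => i _; case: (x j i != y i).
have CS : (\sum_(i in I) q i) ^+ 2 <= #|I|%:R * \sum_(i in I) q i ^+ 2.
  have [->|I0] := eqVneq I finset.set0; first by rewrite !big_set0 mulr0 expr0n.
  set m := (\sum_(i in I) q i) / #|I|%:R.
  have cI : 0 < #|I|%:R :> R by rewrite ltr0n card_gt0.
  have : 0 <= \sum_(i in I) (q i - m) ^+ 2 by apply: sumr_ge0 => i _; exact: sqr_ge0.
  rewrite (eq_bigr (fun i => q i ^+ 2 - 2 * m * q i + m ^+ 2)); last first.
    by move=> i _; ring.
  rewrite big_split/= sumrB -mulr_sumr sumr_const -[_ *+ #|I|]mulr_natl /m => h.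
  rewrite -ler_pdivrMl// -subr_ge0; apply: le_trans h _.
  by rewrite le_eqVlt; apply/orP; left; apply/eqP; field; rewrite gt_eqF.
have QI : \sum_(i in I) q i ^+ 2 <= \sum_i q i ^+ 2.
  rewrite [leRHS](bigID (mem I))/= lerDl; apply: sumr_ge0 => i _; exact: sqr_ge0.
have Q0 : 0 <= \sum_i q i ^+ 2 by apply: sumr_ge0 => i _; exact: sqr_ge0.
rewrite addrC subr_ge0 -/(q _) /prod_cost.
rewrite -[X in _ <= X / _]/(\sum_i q i ^+ 2).
rewrite ler_pdivrMr ?mulr_gt0//.
have : r ^+ 2 <= (\sum_(i in I) q i) ^+ 2.
  by rewrite ler_sqr ?nnegrE// sumr_ge0.
have : #|I|%:R * \sum_(i in I) q i ^+ 2 <= s * \sum_i q i ^+ 2.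
  apply: ler_pM => //; apply: sumr_ge0 => i _; exact: sqr_ge0.
lra.
Qed.

(** * Real-valued probabilities and medians *)

Section fine_probability.
Context d (T : measurableType d) (R : realType) (P : probability T R).
Implicit Types A B : set T.

Lemma probabilityE A : measurable A -> P A = (fine (P A))%:E.
Proof. by move=> mA; rewrite fineK// fin_num_measure. Qed.

Lemma fine_probability_ge0 A : 0 <= fine (P A).
Proof. exact: fine_ge0. Qed.

Lemma fine_probability_le1 A : measurable A -> fine (P A) <= 1.
Proof. by move=> mA; rewrite -lee_fin -probabilityE// probability_le1. Qed.

Lemma le_fine_probability A B : measurable A -> measurable B -> A `<=` B ->
  fine (P A) <= fine (P B).
Proof.
by move=> mA mB AB; rewrite -lee_fin -!probabilityE// le_measure// inE.
Qed.

Lemma fine_probability_setC A : measurable A -> fine (P (~` A)) = 1 - fine (P A).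
Proof.
by move=> mA; rewrite probability_setC// probabilityE.
Qed.

Lemma fine_probabilityU A B : measurable A -> measurable B ->
  fine (P (A `|` B)) <= fine (P A) + fine (P B).
Proof.
move=> mA mB; rewrite -lee_fin EFinD -!probabilityE//; last exact: measurableU.
exact: measureU2.
Qed.

Lemma fine_probabilityD A B : measurable A -> measurable B ->
  fine (P A) - fine (P B) <= fine (P (A `\` B)).
Proof.
move=> mA mB; have mD := measurableD mA mB.
rewrite lerBlDr; apply: le_trans (fine_probabilityU mD mB).
apply: le_fine_probability => //; first exact: measurableU.
by move=> w Aw; have [Bw|Bw] := pselect (B w); [right|left].
Qed.

Lemma fine_probability_bigcup_le (F : (set T)^nat) (a : R) :
  (forall k, measurable (F k)) -> {homo F : m n / (m <= n)%N >-> (m <= n)%O} ->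
  (forall k, fine (P (F k)) <= a) -> fine (P (\bigcup_k F k)) <= a.
Proof.
move=> mF ndF Fa; have mU : measurable (\bigcup_k F k) by exact: bigcup_measurable.
rewrite -lee_fin -probabilityE//.
have /cvg_lim <- // := nondecreasing_cvg_mu (mu := P) mF mU ndF.
apply: lime_le.
  by apply/cvg_ex; exists (P (\bigcup_k F k)); exact: nondecreasing_cvg_mu.
by apply: nearW => k; rewrite /= probabilityE// lee_fin.
Qed.

Lemma measurable_set_ler (f g : T -> R) :
  measurable_fun setT f -> measurable_fun setT g ->
  measurable [set w | f w <= g w].
Proof.
by move=> mf mg; rewrite -[X in measurable X]setTI; exact: measurable_fun_le.
Qed.

Lemma measurable_set_ltr (f g : T -> R) :
  measurable_fun setT f -> measurable_fun setT g ->
  measurable [set w | f w < g w].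
Proof.
move=> mf mg; rewrite (_ : [set _ | _] = ~` [set w | g w <= f w]).
  exact/measurableC/measurable_set_ler.
by apply/seteqP; split=> w /=; [rewrite ltNge => /negP|move/negP; rewrite -ltNge].
Qed.

(** The median is the infimum of [S]. That [S] is nonempty and bounded below, and both inequalities
    at [inf S], are each obtained by writing an event as an increasing union of events of
    probability at most [1/2]. *)
Lemma exists_median (X : T -> R) : measurable_fun setT X -> exists m,
  1 / 2 <= fine (P [set w | X w <= m]) /\ 1 / 2 <= fine (P [set w | m <= X w]).
Proof.
move=> mX.
have mle a : measurable [set w | X w <= a] by exact: measurable_set_ler.
have mge a : measurable [set w | a <= X w] by exact: measurable_set_ler.
have mlt a : measurable [set w | X w < a] by exact: measurable_set_ltr.
have mgt a : measurable [set w | a < X w] by exact: measurable_set_ltr.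
have gtE a : fine (P [set w | a < X w]) = 1 - fine (P [set w | X w <= a]).
  rewrite -fine_probability_setC//; congr (fine (P _)).
  by apply/seteqP; split=> w /=; [rewrite ltNge => /negP|move/negP; rewrite -ltNge].
have geE a : fine (P [set w | a <= X w]) = 1 - fine (P [set w | X w < a]).
  rewrite -fine_probability_setC//; congr (fine (P _)).
  by apply/seteqP; split=> w /=; [rewrite leNgt => /negP|move/negP; rewrite -leNgt].
pose S := [set x | 1 / 2 <= fine (P [set w | X w <= x])].
have PT : fine (P setT) = 1 by rewrite probability_setT.
have S0 : S !=set0.
  apply: contrapT => S0.
  have : fine (P (\bigcup_k [set w | X w <= k%:R])) <= 1 / 2.
    apply: fine_probability_bigcup_le => // [m n mn|k].
      by apply/subsetPset => w /= /le_trans; apply; rewrite ler_nat.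
    by rewrite leNgt; apply/negP => /ltW kS; apply: S0; exists k%:R.
  rewrite (_ : \bigcup_k _ = setT) ?PT; first by lra.
  apply/seteqP; split=> // w _; exists (Num.bound `|X w|) => //=.
  exact: le_trans (ler_norm _) (ltW (archi_boundP (normr_ge0 _))).
have Slb : has_lbound S.
  apply: contrapT => Slb.
  have : fine (P (\bigcup_k [set w | - k%:R < X w])) <= 1 / 2.
    apply: fine_probability_bigcup_le => // [m n mn|k].
      by apply/subsetPset => w /=; apply: le_lt_trans; rewrite lerN2 ler_nat.
    rewrite gtE lerBlDr -lerBlDl leNgt; apply/negP => kS; apply: Slb.
    exists (- k%:R) => x xS; rewrite leNgt; apply/negP => xk.
    have : fine (P [set w | X w <= x]) <= fine (P [set w | X w <= - k%:R]).
      by apply: le_fine_probability => // w /= /le_trans; apply; exact: ltW.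
    by move: xS kS; rewrite /S/=; lra.
  rewrite (_ : \bigcup_k _ = setT) ?PT; first by lra.
  apply/seteqP; split=> // w _; exists (Num.bound `|X w|) => //=.
  rewrite ltrNl; apply: le_lt_trans (archi_boundP (normr_ge0 _)).
  by rewrite -normrN ler_norm.
have invn (x : R) : 0 < x -> exists k, k.+1%:R^-1 < x.
  move=> x0; exists (Num.bound x^-1).
  rewrite invf_plt ?posrE//; apply: lt_trans (archi_boundP _) _.
    by rewrite invr_ge0 ltW.
  by rewrite ltr_nat.
have invn_le m n : (m <= n)%N -> (n.+1%:R^-1 : R) <= m.+1%:R^-1.
  by move=> mn; rewrite lef_pV2 ?posrE// ler_nat ltnS.
exists (inf S); split.
- have : fine (P (\bigcup_k [set w | inf S + k.+1%:R^-1 < X w])) <= 1 / 2.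
    apply: fine_probability_bigcup_le => // [m n mn|k].
      by apply/subsetPset => w /=; apply: le_lt_trans; rewrite lerD2l invn_le.
    rewrite gtE lerBlDr -lerBlDl.
    have k0 : 0 < k.+1%:R^-1 :> R by rewrite invr_gt0.
    have [x xS xk] := inf_adherent k0 (conj S0 Slb).
    have : fine (P [set w | X w <= x]) <= fine (P [set w | X w <= inf S + k.+1%:R^-1]).
      by apply: le_fine_probability => // w /= /le_trans; apply; exact: ltW.
    by move: xS; rewrite /S/=; lra.
  rewrite (_ : \bigcup_k _ = [set w | inf S < X w]); first by rewrite gtE; lra.
  apply/seteqP; split=> w /=.
    by move=> [k _ /=]; apply: lt_trans; rewrite ltrDl invr_gt0.
  rewrite -subr_gt0 => /invn[k kX]; exists k => //=; by rewrite -ltrBrDl.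
- have : fine (P (\bigcup_k [set w | X w <= inf S - k.+1%:R^-1])) <= 1 / 2.
    apply: fine_probability_bigcup_le => // [m n mn|k].
      by apply/subsetPset => w /= /le_trans; apply; rewrite lerD2l lerN2 invn_le.
    rewrite leNgt; apply/negP => /ltW kS.
    have : inf S <= inf S - k.+1%:R^-1 by exact: ge_inf.
    by rewrite lerDl oppr_ge0 leNgt invr_gt0 ltr0n.
  rewrite (_ : \bigcup_k _ = [set w | X w < inf S]); first by rewrite geE; lra.
  apply/seteqP; split=> w /=.
    by move=> [k _ /=] /le_lt_trans; apply; rewrite gtrDl oppr_lt0 invr_gt0.
  rewrite -subr_gt0 => /invn[k kX]; exists k => //=; by rewrite lerBrDr -lerBrDl ltW.
Qed.

End fine_probability.

(** * Deviation from a median *)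

Section deviation.
Context (R : realType) (n : nat) (d : 'I_n -> measure_display)
  (T : forall i, measurableType (d i)) (P_ : forall i, probability (T i) R).
Variables (Ostar : set (prod_space T)) (X : prod_space T -> R) (s c : R).
Hypotheses (mO : measurable Ostar) (mX : measurable_fun setT X).
Hypotheses (c0 : 0 < c) (s0 : 0 < s).
Hypothesis certX :
  upward_certificates Ostar s c X \/ downward_certificates Ostar s c X.

Let P := prod_probability P_.
Let pr A := fine (P A).

Let diff_onC (I : {set 'I_n}) (w w' : prod_space T) : diff_on I w w' = diff_on I w' w.
Proof. by apply: eq_card => i; rewrite !inE eq_sym. Qed.

(** Apply the certificate with gap [b - a]: a point of the opposite tail that differed in fewer than
    [(b - a) / c] coordinates of [I] would violate it. Upward certificates are taken at points of
    the upper tail, downward ones at points of the lower tail. *)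
Lemma certificates_tails (a b : R) : a < b ->
  pr ([set w | X w <= a] `\` Ostar) * pr ([set w | b <= X w] `\` Ostar) <=
  expR (- (((b - a) / c) ^+ 2 / (4 * s))).
Proof.
move=> ab.
have mA : measurable ([set w | X w <= a] `\` Ostar).
  by apply: measurableD => //; exact: measurable_set_ler.
have mB : measurable ([set w | b <= X w] `\` Ostar).
  by apply: measurableD => //; exact: measurable_set_ler.
have ba : 0 < b - a by rewrite subr_gt0.
have r0 : 0 <= (b - a) / c by rewrite divr_ge0 ?ltW.
case: certX => cert.
- apply: talagrand_certificates => // y [/= by_ Oy].
  have [I [Is Icert]] := cert _ ba y Oy; exists I; split=> // x [/= xa Ox].
  rewrite leNgt; apply/negP; rewrite diff_onC => /(Icert x Ox); lra.
- rewrite mulrC; apply: talagrand_certificates => // y [/= ya Oy].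
  have [I [Is Icert]] := cert _ ba y Oy; exists I; split=> // x [/= xb Ox].
  rewrite leNgt; apply/negP; rewrite diff_onC => /(Icert x Ox); lra.
Qed.

(** Two points differ in at most [n < n.+1] coordinates, so the certificate for [c * n.+1%:R] always
    applies. The bound makes the number of layers below finite. *)
Lemma certificates_oscillation w w' : ~ Ostar w -> ~ Ostar w' ->
  `|X w - X w'| <= c * n.+1%:R.
Proof.
have t0 : 0 < c * n.+1%:R by rewrite mulr_gt0.
have small (I : {set 'I_n}) (v v' : prod_space T) : (diff_on I v v')%:R < c * n.+1%:R / c.
  rewrite mulrAC divff ?gt_eqF// mul1r ltr_nat ltnS.
  by rewrite -[leqRHS]card_ord; exact: max_card.
move=> Ow Ow'; rewrite ler_norml; case: certX => cert.
- have [I [_ /(_ w' Ow' (small _ _ _))]] := cert _ t0 w Ow.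
  have [J [_ /(_ w Ow (small _ _ _))]] := cert _ t0 w' Ow'.
  by lra.
- have [I [_ /(_ w' Ow' (small _ _ _))]] := cert _ t0 w Ow.
  have [J [_ /(_ w Ow (small _ _ _))]] := cert _ t0 w' Ow'.
  by lra.
Qed.

Variable m : R.
Hypotheses (medl : 1 / 2 <= pr [set w | X w <= m])
  (medr : 1 / 2 <= pr [set w | m <= X w]).

Let mdev t : measurable [set w | t <= `|X w - m|].
Proof.
by apply: measurable_set_ler => //; apply/measurableT_comp => //; exact: measurable_funB.
Qed.

(** Each tail is paired with the half-space on the other side of [m], which keeps probability at
    least [1 / 2 - pr Ostar] off [Ostar]. *)
Lemma median_deviation_off (t : R) : 0 < t ->
  pr ([set w | t <= `|X w - m|] `\` Ostar) * (1 / 2 - pr Ostar) <=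
  2 * expR (- ((t / c) ^+ 2 / (4 * s))).
Proof.
move=> t0; set e := expR _; set D := _ `\` _.
have mle a : measurable [set w | X w <= a] by exact: measurable_set_ler.
have mge a : measurable [set w | a <= X w] by exact: measurable_set_ler.
have e0 : 0 < e by exact: expR_gt0.
have D0 : 0 <= pr D by exact: fine_probability_ge0.
have [p12|p12] := leP (1 / 2) (pr Ostar).
  apply: le_trans (_ : 0 <= _); last by rewrite mulr_ge0// ltW.
  by rewrite mulr_ge0_le0// subr_le0.
have DU : pr D <= pr ([set w | X w <= m - t] `\` Ostar) +
                  pr ([set w | m + t <= X w] `\` Ostar).
  apply: le_trans (fine_probabilityU _ _ _); try exact: measurableD.
  apply: le_fine_probability; [exact: measurableD|by apply: measurableU; exact: measurableD|].
  move=> w [/= + Ow]; rewrite ler_normr => /orP[h|h]; [right|left]; split=> //=; lra.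
have hl : pr ([set w | X w <= m - t] `\` Ostar) * (1 / 2 - pr Ostar) <= e.
  have := @certificates_tails (m - t) m ltac:(lra).
  rewrite (_ : m - (m - t) = t); last by ring.
  apply: le_trans.
  apply: ler_wpM2l; first exact: fine_probability_ge0.
  by apply: le_trans (fine_probabilityD _ _ _) => //; rewrite lerD2r.
have hr : pr ([set w | m + t <= X w] `\` Ostar) * (1 / 2 - pr Ostar) <= e.
  have := @certificates_tails m (m + t) ltac:(lra).
  rewrite (_ : m + t - m = t); last by ring.
  rewrite mulrC; apply: le_trans.
  apply: ler_wpM2l; first exact: fine_probability_ge0.
  by apply: le_trans (fine_probabilityD _ _ _) => //; rewrite lerD2r.
apply: le_trans (ler_wpM2r _ DU) _; first by lra.
rewrite mulrDl; lra.
Qed.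

(** From [q * (1 / 2 - pr Ostar) <= 2 * e], with [e] the exponential, and [q <= 1] follows
    [q <= 4 * e + 2 * pr Ostar]; the part inside [Ostar] adds one more [pr Ostar]. *)
Lemma median_deviation (t : R) : 0 < t ->
  pr [set w | t <= `|X w - m|] <=
  4 * expR (- ((t / c) ^+ 2 / (4 * s))) + 3 * pr Ostar.
Proof.
move=> t0; have := median_deviation_off t0.
have := fine_probabilityD P (mdev t) mO; rewrite -/(pr _) -/(pr _) -/(pr _).
set q := pr (_ `\` _).
have q1 : q <= 1 by apply: fine_probability_le1; exact: measurableD.
have O0 : 0 <= pr Ostar by exact: fine_probability_ge0.
have : q * pr Ostar <= pr Ostar by rewrite ler_piMl.
lra.
Qed.

Let layer_sum (y h : R) (K : nat) : 0 < h -> y <= h * K.+1%:R ->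
  y <= h * (1 + \sum_(k < K) (k.+1%:R * h <= y)%R%:R).
Proof.
move=> h0; elim: K => [|K IH] yK; first by rewrite big_ord0 addr0 mulr1 in yK *.
have [/IH yle|yK1] := leP y (h * K.+1%:R).
  apply: (le_trans yle); rewrite ler_pM2l// lerD2l big_ord_recr/= lerDl ler0n //.
apply: (le_trans yK); rewrite ler_pM2l// (eq_bigr (fun=> 1)) => [|k _].
  by rewrite sumr_const card_ord -natr1 addrC.
by rewrite (le_trans _ (ltW yK1))// mulrC ler_pM2l// ler_nat ltn_ord.
Qed.

(** Replaces the Gaussian tail by a geometric series, using [2 <= expR 1]. *)
Lemma expR_sqr_le (k : nat) : expR (- (k.+1%:R ^+ 2)) <= (1 / 2) ^+ k.+1 :> R.
Proof.
apply: le_trans (_ : expR (- 1 * k.+1%:R) <= _).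
  rewrite ler_expR mulN1r lerN2 -natrX ler_nat.
  by rewrite -{1}(expn1 k.+1) leq_pexp2l.
rewrite expRM powR_mulrn ?expR_ge0// lerXn2r ?nnegrE ?expR_ge0//.
have := expR_ge1Dx (1 : R); rewrite expRN div1r => h.
by rewrite lef_pV2 ?posrE ?expR_gt0.
Qed.

Let sum_half (K : nat) : \sum_(k < K) (1 / 2 : R) ^+ k.+1 = 1 - (1 / 2) ^+ K.
Proof.
elim: K => [|K IH]; first by rewrite big_ord0 expr0 subrr.
rewrite big_ord_recr/= IH exprS; lra.
Qed.

(** The layer width [h] turns the exponent at level [k.+1%:R * h] into [k.+1%:R ^+ 2]. The layers
    have total probability at most 8, so the integral is at most [h * (1 + 8)]. *)
Lemma integral_median_deviation_off : pr Ostar <= 1 / 4 ->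
  (\int[P]_(w in ~` Ostar) (`|X w - m|)%:E <= (18 * c * Num.sqrt s)%:E)%E.
Proof.
move=> p4; set h := 2 * c * Num.sqrt s.
have h0 : 0 < h by rewrite !mulr_gt0// sqrtr_gt0.
pose D k := [set w | k.+1%:R * h <= `|X w - m|] `\` Ostar.
have mD k : measurable (D k) by exact: measurableD.
(* The factor 8 is 2 divided by [1 / 4], a lower bound for [1 / 2 - pr Ostar]. *)
have prD k : pr (D k) <= 8 * (1 / 2) ^+ k.+1.
  have kh : 0 < k.+1%:R * h by rewrite mulr_gt0.
  have := median_deviation_off kh; rewrite -/(D k).
  rewrite (_ : (_ / c) ^+ 2 / (4 * s) = k.+1%:R ^+ 2); last first.
    have -> : k.+1%:R * h / c = 2 * k.+1%:R * Num.sqrt s.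
      by rewrite /h; field; rewrite gt_eqF.
    by rewrite exprMn sqr_sqrtr ?(ltW s0)//; field; rewrite gt_eqF.
  have := expR_sqr_le k; have : 0 <= pr (D k) by exact: fine_probability_ge0.
  nra.
have [w0 Ow0] : exists w0, ~ Ostar w0.
  apply: contrapT => OT; have : pr Ostar = 1.
    rewrite (_ : Ostar = setT) /pr ?probability_setT//.
    by apply/seteqP; split=> // w _; apply: contrapT => Ow; apply: OT; exists w.
  by lra.
pose L := c * n.+1%:R + `|X w0 - m|.
have XL w : ~ Ostar w -> `|X w - m| <= L.
  move=> Ow; apply: le_trans (ler_distD (X w0) _ _) _.
  by rewrite lerD2r; exact: certificates_oscillation.
pose K := Num.bound (L / h).
have LK : L <= h * K.+1%:R.
  rewrite -ler_pdivrMl// mulrC; apply: ltW; apply: lt_trans (archi_boundP _) _.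
    by rewrite divr_ge0 ?(ltW h0)// addr_ge0// mulr_ge0// ltW.
  by rewrite ltr_nat.
pose Y w := h * (1 + \sum_(k < K) \1_(D k) w).
have Y0 w : 0 <= Y w by rewrite mulr_ge0 ?(ltW h0)// addr_ge0// sumr_ge0.
have mY : measurable_fun setT Y.
  apply: measurable_funM => //; apply: measurable_funD => //.
  by apply: measurable_sum => k; exact: measurable_indic.
have XY w : ~ Ostar w -> `|X w - m| <= Y w.
  move=> Ow; apply: le_trans (layer_sum h0 (le_trans (XL w Ow) LK)) _.
  rewrite ler_pM2l// lerD2l; apply: ler_sum => k _; rewrite indicE.
  have [kX|] := leP (k.+1%:R * h); last by [].
  by rewrite mem_set.
apply: le_trans (_ : (\int[P]_(w in ~` Ostar) (Y w)%:E <= _)%E).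
  apply: ge0_le_integral => //; first exact: measurableC.
  - by apply/measurable_EFinP/measurable_funTS/measurableT_comp => //; exact: measurable_funB.
  - exact/measurable_EFinP/measurable_funTS.
apply: le_trans (_ : (\int[P]_w (Y w)%:E <= _)%E).
  apply: ge0_subset_integral => //; first exact: measurableC.
    exact/measurable_EFinP.
  by move=> w _; rewrite lee_fin.
have -> : (\int[P]_w (Y w)%:E = (h * (1 + \sum_(k < K) pr (D k)))%:E)%E.
  rewrite /Y.
  under eq_integral do rewrite EFinM EFinD -sumEFin.
  rewrite ge0_integralZl//; last 3 first.
  - apply: emeasurable_funD => //; apply: emeasurable_sum => k.
    exact/measurable_EFinP/measurable_indic.
  - by move=> w _; rewrite adde_ge0// sume_ge0// => k _; rewrite lee_fin.
  - by rewrite lee_fin ltW.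
  rewrite ge0_integralD//; last 2 first.
  - by move=> w _; rewrite sume_ge0// => k _; rewrite lee_fin.
  - by apply: emeasurable_sum => k; exact/measurable_EFinP/measurable_indic.
  rewrite ge0_integral_sum//; last first.
    by move=> k; exact/measurable_EFinP/measurable_indic.
  rewrite integral_cst//= probability_setT mule1 [RHS]EFinM EFinD -sumEFin.
  congr (_ * (_ + _))%E; apply: eq_bigr => k _.
  by rewrite integral_indic// setIT /pr -probabilityE.
rewrite lee_fin (_ : 18 * c * Num.sqrt s = h * 9); last by rewrite /h; ring.
rewrite ler_pM2l//.
apply: le_trans (_ : 1 + \sum_(k < K) 8 * (1 / 2) ^+ k.+1 <= _).
  by rewrite lerD2l; apply: ler_sum.
rewrite -mulr_sumr sum_half.
have : 0 <= (1 / 2) ^+ K :> R by rewrite exprn_ge0.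
lra.
Qed.

End deviation.

(** * Distance between mean and median *)

Lemma sup_abs1P (R : realType) (n : nat) (d : 'I_n -> measure_display)
    (T : forall i, measurableType (d i)) (X : prod_space T -> R) :
  sup_abs1 X = +oo%E \/
  exists M, [/\ sup_abs1 X = M%:E, 1 <= M & forall w, `|X w| <= M].
Proof.
have X1 : (1 <= sup_abs1 X)%E by rewrite /sup_abs1 le_max lexx orbT.
have Xs w : (`|X w|%:E <= sup_abs1 X)%E.
  by rewrite /sup_abs1 le_max ereal_sup_ubound//; exists w.
case E : (sup_abs1 X) X1 Xs => [M| |] // X1 Xs; [right; exists M; split=> //|by left].
Qed.

Section mean.
Context (R : realType) (n : nat) (d : 'I_n -> measure_display)
  (T : forall i, measurableType (d i)) (P_ : forall i, probability (T i) R).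
Variables (Ostar : set (prod_space T)) (X : prod_space T -> R) (s c : R).
Hypotheses (mO : measurable Ostar) (mX : measurable_fun setT X).

Let P := prod_probability P_.
Let pr A := fine (P A).

Hypothesis PO : (P Ostar <= (sup_abs1 X ^+ 2)^-1)%E.

Variable m : R.
Hypotheses (medl : 1 / 2 <= pr [set w | X w <= m])
  (medr : 1 / 2 <= pr [set w | m <= X w]).

Let mXm : measurable_fun setT (fun w => X w - m).
Proof. exact: measurable_funB. Qed.

(** On [Ostar] the integrand is at most [2 * M], and [2 * M / M ^+ 2 <= 2]. If the supremum is
    infinite, [Ostar] is a null set. *)
Lemma integral_median_deviation_on :
  (\int[P]_(w in Ostar) (`|X w - m|)%:E <= 2%:E)%E.
Proof.
have mf : measurable_fun Ostar (fun w => (`|X w - m|)%:E).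
  by apply/measurable_EFinP/measurable_funTS/measurableT_comp.
have [Xy|[M [XM M1 XleM]]] := sup_abs1P X.
  rewrite null_set_integral// ?lee_fin//.
  apply/eqP; rewrite eq_le measure_ge0 andbT (le_trans PO)//.
  by rewrite Xy expe2 mulyy invey.
have nonempty (A : set (prod_space T)) : 1 / 2 <= pr A -> exists w, A w.
  move=> A12; apply: contrapT => A0; move: A12.
  rewrite (_ : A = set0) /pr ?measure0/=; first lra.
  by apply/seteqP; split=> // w Aw; apply: A0; exists w.
have [w /= wm] := nonempty _ medl; have [v /= mv] := nonempty _ medr.
(* The median lies between two values of [X]. *)
have mM : `|m| <= M.
  have := XleM w; have := XleM v; rewrite !ler_norml; lra.
apply: le_trans (_ : (\int[P]_(w in Ostar) (2 * M)%:E <= _)%E).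
  apply: ge0_le_integral => //.
  move=> u _; rewrite lee_fin; apply: le_trans (ler_normB _ _) _.
  have := XleM u; lra.
rewrite integral_cst//.
apply: le_trans (_ : (2 * M)%:E * (M ^+ 2)^-1%:E <= _)%E.
  apply: lee_wpmul2l; first by rewrite lee_fin mulr_ge0// (le_trans _ M1).
  apply: (le_trans PO); rewrite XM -EFin_expe inver.
  by rewrite expf_eq0/= gt_eqF ?(lt_le_trans _ M1).
rewrite -EFinM lee_fin ler_pdivrMr ?exprn_gt0 ?(lt_le_trans _ M1)//.
by nra.
Qed.

Hypotheses (c1 : 1 <= c) (s1 : 1 <= s).
Hypothesis certX :
  upward_certificates Ostar s c X \/ downward_certificates Ostar s c X.

(** The integrals off and on [Ostar] add up to [18 * c * Num.sqrt s + 2], and [1 <= c * Num.sqrt s]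
    absorbs the 2. Their finiteness also makes [X] integrable. *)
Lemma mean_median : pr Ostar <= 1 / 4 -> exists mu : R,
  (\int[P]_w (X w)%:E = mu%:E)%E /\ `|mu - m| <= 20 * c * Num.sqrt s.
Proof.
move=> p4; set b := 20 * c * Num.sqrt s.
have c0 : 0 < c by apply: lt_le_trans c1.
have s0 : 0 < s by apply: lt_le_trans s1.
have sc1 : 1 <= c * Num.sqrt s.
  have q1 : 1 <= Num.sqrt s by rewrite -[leLHS]sqrtr1 ler_wsqrtr.
  by rewrite mulr_ege1.
have Ib : (\int[P]_w (`|X w - m|)%:E <= b%:E)%E.
  rewrite -(setvU Ostar) ge0_integral_setU//; last 3 first.
  - exact: measurableC.
  - by rewrite setvU; apply/measurable_EFinP/measurableT_comp.
  - by apply/disj_setPS => w [].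
  apply: le_trans (leeD (integral_median_deviation_off mO mX c0 s0 certX medl medr p4)
    integral_median_deviation_on) _.
  by rewrite -EFinD lee_fin /b; lra.
have iXm : P.-integrable setT (EFin \o (fun w => X w - m)).
  apply/integrableP; split; first exact/measurable_EFinP.
  exact: le_lt_trans Ib (ltry _).
have im : P.-integrable setT (EFin \o cst m) by exact: finite_measure_integrable_cst.
have iX : P.-integrable setT (EFin \o X).
  rewrite (_ : EFin \o X = ((EFin \o (fun w => (X w - m)%R)) \+ (EFin \o cst m))%E).
    exact: integrableD.
  by apply/funext => w /=; rewrite -EFinD subrK.
exists (\int[P]_w X w); split; first by rewrite /Rintegral fineK// integrable_fin_num.
have -> : \int[P]_w X w - m = \int[P]_w (X w - m).
  by rewrite RintegralB// Rintegral_cst//= probability_setT mulr1.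
apply: le_trans (le_normr_Rintegral _ iXm) _ => //.
rewrite -lee_fin /Rintegral fineK//.
by rewrite ge0_fin_numE ?integral_ge0// (le_lt_trans Ib)// ltry.
Qed.

End mean.

(** * Deviation from the mean *)

Theorem theorem12 (R : realType) (n : nat) (d : 'I_n -> measure_display)
    (T : forall i, measurableType (d i)) (P_ : forall i, probability (T i) R)
    (Ostar : set (prod_space T)) (X : {RV (prod_probability P_) >-> R})
    (s c : R) :
  measurable Ostar ->
  1 <= c ->
  1 <= s ->
  (prod_probability P_ Ostar <= (sup_abs1 X ^+ 2)^-1)%E ->
  upward_certificates Ostar s c X \/ downward_certificates Ostar s c X ->
  forall t : R, 50 * c * Num.sqrt s < t ->
  (prod_probability P_
     [set w | t%:E <= `|(X w)%:E - 'E_(prod_probability P_)[X]|]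
   <= (4 * expR (- (t ^+ 2 / (16 * c ^+ 2 * s))))%:E
      + 4%:E * prod_probability P_ Ostar)%E.
Proof.
move=> mO c1 s1 PO certX t tcs.
have mX : measurable_fun setT X by exact: measurable_funPT.
set P := prod_probability P_ in PO *.
have EX : ('E_P[X] = \int[P]_w (X w)%:E)%E by rewrite unlock.
have c0 : 0 < c by apply: lt_le_trans c1.
have s0 : 0 < s by apply: lt_le_trans s1.
have sc1 : 1 <= c * Num.sqrt s.
  have q1 : 1 <= Num.sqrt s by rewrite -[leLHS]sqrtr1 ler_wsqrtr.
  by rewrite mulr_ege1.
have t50 : 50 < t by lra.
have PE A : measurable A -> P A = (fine (P A))%:E by exact: probabilityE.
have p0 : 0 <= fine (P Ostar) by exact: fine_ge0.
have rhsE : ((4 * expR (- (t ^+ 2 / (16 * c ^+ 2 * s))))%:E + 4%:E * P Ostar =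
    (4 * expR (- (t ^+ 2 / (16 * c ^+ 2 * s))) + 4 * fine (P Ostar))%:E)%E.
  by rewrite (PE Ostar)// -EFinM -EFinD.
rewrite {}rhsE; set e := expR _.
have e0 : 0 < e by exact: expR_gt0.
(* If [Ostar] has probability above [1 / 4], then [M < 2], so [X] stays within [2 * M < 4] of its
   mean and the event is empty. *)
have [p4|p4] := leP (fine (P Ostar)) (1 / 4); last first.
  have [Xy|[M [XM M1 XleM]]] := sup_abs1P X.
    move: PO p4; rewrite Xy expe2 mulyy invey => PO.
    have -> : P Ostar = 0%E by apply/eqP; rewrite eq_le PO measure_ge0.
    by rewrite /= {PO} => p4; exfalso; lra.
  have M2 : M < 2.
    have M0 : 0 < M by apply: lt_le_trans M1.
    move: PO; rewrite XM -EFin_expe inver expf_eq0/= gt_eqF// (PE Ostar)// lee_fin => PO.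
    have : 1 / 4 < (M ^+ 2)^-1 by apply: lt_le_trans PO.
    rewrite -[X in X < _]invrK ltf_pV2 ?posrE ?exprn_gt0 ?invr_gt0// => M4.
    by nra.
  have EM : (`|'E_P[X]| <= M%:E)%E.
    rewrite EX; apply: (le_trans (le_abse_integral _ _ _)) => //.
      exact/measurable_EFinP.
    apply: le_trans (_ : (\int[P]_w M%:E <= _)%E).
      apply: ge0_le_integral => //.
      - by apply/measurable_EFinP/measurableT_comp.
      - by move=> w _; rewrite lee_fin.
    by rewrite integral_cst//= probability_setT mule1.
  rewrite (_ : [set _ | _] = set0) ?measure0 ?lee_fin; first by lra.
  apply/seteqP; split=> // w /=; apply/negP; rewrite -ltNge.
  apply: le_lt_trans (lee_abs_sub _ _) _.
  apply: le_lt_trans (leeD (_ : _ <= M%:E)%E EM) _; first by rewrite lee_fin.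
  by rewrite -EFinD lte_fin; lra.
have [m [ml mr]] := exists_median P mX.
have [mu [muE mum]] := mean_median mO mX PO ml mr c1 s1 certX p4.
have mdev (x r : R) : measurable [set w | r <= `|X w - x|].
  by apply: measurable_set_ler => //; apply/measurableT_comp => //; exact: measurable_funB.
(* Half of [t] covers the distance from mean to median, as [20 * c * Num.sqrt s < t / 2]; the other
   half is the deviation from the median and yields the 16 in the exponent. *)
have t2 : 0 < t / 2 by lra.
have := median_deviation mO mX c0 s0 certX ml mr t2.
have -> : (t / 2 / c) ^+ 2 / (4 * s) = t ^+ 2 / (16 * c ^+ 2 * s).
  by field; rewrite !gt_eqF.
rewrite -/P -/e => tail.
rewrite EX muE (_ : [set _ | _] = [set w | t <= `|X w - mu|]); last first.
  by apply/seteqP; split=> w /=; rewrite lee_fin.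
rewrite PE// lee_fin.
apply: le_trans (_ : fine (P [set w | t / 2 <= `|X w - m|]) <= _).
  apply: le_fine_probability => // w /= tX.
  have := ler_distD m (X w) mu; rewrite (distrC m mu); lra.
by lra.
Qed.
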